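(* Let $E$ be a finite-dimensional real normed linear space of dimension $n\ge 1$ and let $r>0$. (a) If $C$ is an $r$-maximal subset of $E$, then $C$ is a compact convex set with nonempty interior. (b) If $C\subset E$ is a compact convex set of constant diameter $r$, then $C$ is an $r$-maximal subset of $E$.
   Context: $E$ carries the metric $d(x,y)=|x-y|$ coming from its norm. A subset of $E$ is $r$-bounded if its diameter is at most $r$; it is $r$-maximal if it is maximal (with respect to inclusion) among the $r$-bounded subsets of $E$. $S^*$ denotes the unit sphere of the dual space $E^*$ (with the dual norm). For $\omega\in S^*$ the $\omega$ diameter of a subset $C$ is $\sup\{\omega(x_1-x_2):x_1,x_2\in C\}$. $C$ has constant diameter $r$ if its $\omega$ diameter equals $r$ for every $\omega\in S^*$. *)

(* Defs.v *)
From HB Require Import structures.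
From mathcomp Require Import all_boot all_order all_algebra.
From mathcomp Require Import all_classical all_reals all_analysis.

Set Implicit Arguments.
Unset Strict Implicit.
Unset Printing Implicit Defensive.

Import Order.TTheory GRing.Theory Num.Theory.
Import numFieldNormedType.Exports.

Local Open Scope classical_set_scope.
Local Open Scope ring_scope.

(* Diameters are suprema in [\bar R]: they are [+oo] on unbounded sets and
   [-oo] on the empty set, which is therefore [r]-bounded for every [r]. *)
Definition diam (R : realType) (E : normedModType R) (C : set E) : \bar R :=
  ereal_sup [set (`|p.1 - p.2|)%:E | p in C `*` C].

Definition r_bounded (R : realType) (E : normedModType R) (r : R)
    (C : set E) : Prop :=
  (diam C <= r%:E)%E.

Definition r_maximal (R : realType) (E : normedModType R) (r : R)
    (C : set E) : Prop :=
  r_bounded r C /\ forall D : set E, r_bounded r D -> C `<=` D -> D = C.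

Definition dual_norm (R : realType) (E : normedModType R)
    (w : {linear E -> R^o}) : \bar R :=
  ereal_sup [set (`|w x|)%:E | x in [set x : E | `|x| <= 1]].

Definition dual_sphere (R : realType) (E : normedModType R) :
    set {linear E -> R^o} :=
  [set w : {linear E -> R^o} | continuous w /\ dual_norm w = 1%E].

Definition omega_diam (R : realType) (E : normedModType R)
    (w : {linear E -> R^o}) (C : set E) : \bar R :=
  ereal_sup [set (w (p.1 - p.2) : R)%:E | p in C `*` C].

Definition constant_diameter (R : realType) (E : normedModType R) (r : R)
    (C : set E) : Prop :=
  forall w : {linear E -> R^o}, dual_sphere w -> omega_diam w C = r%:E.

(* Main.v *)
Require Import Defs.
From HB Require Import structures.
From mathcomp Require Import all_boot all_order all_algebra.
From mathcomp Require Import all_classical all_reals all_analysis.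
From mathcomp Require Import ring lra.

Set Implicit Arguments.
Unset Strict Implicit.
Unset Printing Implicit Defensive.

Import Order.TTheory GRing.Theory Num.Theory.
Import numFieldNormedType.Exports.

Local Open Scope classical_set_scope.
Local Open Scope ring_scope.

(** Part (a).  If [y] is within [r] of every point of an [r]-maximal set [C],
    adding [y] to [C] keeps it [r]-bounded, so [y] is already in [C]: an
    [r]-maximal set is the intersection of the closed balls of radius [r]
    centred at its own points ([r_maximal_balls]).  Hence [C] is convex, closed
    and bounded, and therefore compact because the dimension is finite.  For
    the interior it is enough to find [c] and [d < r] with [C] inside the
    closed ball of radius [d] about [c], since then the ball of radius [r - d]
    about [c] lies in [C].  The average of a finite [r / 2]-net of [C] is such a
    point ([compact_circumradius_lt]): each [x] in [C] is within [r] of all the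
    points of the net and within [r / 2] of at least one.

    Part (b).  Suppose [C] has constant diameter [r].  A functional of norm 1
    attaining its norm at [x - y] shows that [`|x - y| <= r] on [C].  If [y] is
    outside [C] and [c0] is a point of [C] nearest to [y], then some functional
    [w] of norm 1 satisfies [`|y - c0| <= w (y - c)] for all [c] in [C].  Since
    [C] contains [c1], [c2] with [w (c1 - c2)] arbitrarily close to [r], it
    follows that [`|y - c2| >= w (y - c1) + w (c1 - c2) > r] for a suitable
    choice, so [y] cannot be added to [C].

    Both functionals come from [support_functional], a case of the
    Mazur-Orlicz form of the Hahn-Banach theorem: if [p] is sublinear and
    [b <= p] on a convex set [A], there is a linear [w <= p] with [b <= w] on
    [A].  The only step that constructs something is [sublinear_minorant]; it
    is used for [A] itself, and for the singletons of the vectors of a basis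
    in order to turn a sublinear function into a linear one. *)

(** * Sublinear functions and the Mazur-Orlicz theorem *)

Definition sublinear (R : realType) (V : lmodType R) (p : V -> R) : Prop :=
  (forall x y, p (x + y) <= p x + p y) /\
  (forall t x, 0 <= t -> p (t *: x) = t * p x).

Lemma sublinear_opp_le (R : realType) (V : lmodType R) (p : V -> R) x :
  sublinear p -> - p (- x) <= p x.
Proof.
move=> [pD pZ]; have := pD x (- x).
by rewrite subrr -(scale0r x) pZ// mul0r -lerBlDr sub0r.
Qed.

Lemma sublinear_norm (R : realType) (E : normedModType R) :
  sublinear (fun x : E => `|x|).
Proof. by split=> [x y|t x t0]; rewrite ?ler_normD// normrZ ger0_norm. Qed.

Lemma convex_set_scaled_sum (R : realType) (V : lmodType R) (A : set V)
    (a b : V) (s t : R) :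
  convex_set (A : set (convex_lmodType V)) -> A a -> A b ->
  0 <= s -> 0 <= t -> exists2 c, A c & s *: a + t *: b = (s + t) *: c.
Proof.
move=> cA Aa Ab s0 t0; have [st0|st0] := eqVneq (s + t) 0.
  exists a => //; have {}s0 : s = 0 by lra.
  have {}t0 : t = 0 by lra.
  by rewrite s0 t0 addr0 !scale0r addr0.
have st_gt0 : 0 < s + t by rewrite lt_def st0 addr_ge0.
have l0 : 0 <= s / (s + t) by rewrite divr_ge0// addr_ge0.
have l1 : s / (s + t) <= 1 by rewrite ler_pdivrMr// mul1r lerDl.
exists ((s / (s + t)) *: a + (1 - s / (s + t)) *: b).
  have := cA a b (Itv01 l0 l1); rewrite !inE; exact.
rewrite scalerDr !scalerA; by congr (_ *: _ + _ *: _); field.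
Qed.

Lemma subr_convex_comb (R : realType) (V : lmodType R) (t : R) (x a b : V) :
  x - (t *: a + (1 - t) *: b) = t *: (x - a) + (1 - t) *: (x - b).
Proof.
by rewrite !scalerBr addrACA -scalerDl -opprD addrCA subrr addr0 scale1r.
Qed.

(** The minorant is [q z = inf (p (z + t *: a) - t * b)] over [t >= 0] and
    [a] in [A].  Sublinearity of [p] and [b <= p] on [A] bound these values
    below by [- p (- z)], so the infimum is finite; the pairs
    [(t *: a, t * b)] form a convex cone because [A] is convex, which makes [q]
    sublinear; [t = 0] gives [q <= p] and [t = 1] gives the bound at [- a]. *)
Lemma sublinear_minorant (R : realType) (V : lmodType R) (p : V -> R)
    (A : set V) (b : R) :
  sublinear p -> convex_set (A : set (convex_lmodType V)) -> A !=set0 ->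
  (forall a, A a -> b <= p a) ->
  exists q : V -> R, [/\ sublinear q, forall x, q x <= p x &
    forall a, A a -> q (- a) <= - b].
Proof.
move=> subp cA [a0 Aa0] bp; have [pD pZ] := subp.
pose S z := [set p (z + u.1 *: u.2) - u.1 * b | u in
  [set u : R * V | 0 <= u.1 /\ A u.2]].
pose q z := inf (S z).
have p0 : p 0 = 0 by rewrite -(scale0r (0 : V)) pZ// mul0r.
have Slb z : lbound (S z) (- p (- z)).
  move=> _ [[t a] /= [t0 Aa] <-].
  have := pD (z + t *: a) (- z); rewrite addrAC subrr add0r pZ//.
  by have := ler_wpM2l t0 (bp _ Aa); lra.
have S0 z : S z !=set0.
  by exists (p (z + 0 *: a0) - 0 * b); exists (0, a0).
have qle z t a : 0 <= t -> A a -> q z <= p (z + t *: a) - t * b.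
  by move=> t0 Aa; apply: ge_inf; [exists (- p (- z))|exists (t, a)].
have leq z m : (forall t a, 0 <= t -> A a -> m <= p (z + t *: a) - t * b) ->
    m <= q z.
  move=> zm; apply: lb_le_inf => // _ [[t a] /= [t0 Aa] <-]; exact: zm.
have qp z : q z <= p z.
  by have := qle z _ _ (lexx 0) Aa0; rewrite scale0r mul0r addr0 subr0.
have qZ_le t x : 0 < t -> t * q x <= q (t *: x).
  move=> t0; apply: leq => s a s0 Aa; rewrite -ler_pdivlMl//.
  have ti0 : 0 <= t^-1 by rewrite invr_ge0 ltW.
  apply: le_trans (qle x _ a (mulr_ge0 ti0 s0) Aa) _.
  rewrite mulrDr mulrN mulrA -pZ// scalerDr !scalerA mulVf ?scale1r//.
  by rewrite gt_eqF.
exists q; split => //.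
- split=> [x y|t x].
    suff : forall s a, 0 <= s -> A a -> q (x + y) - (p (x + s *: a) - s * b) <=
      q y.
      move=> H; suff : q (x + y) - q y <= q x by lra.
      by apply: leq => s a s0 Aa; have := H s a s0 Aa; lra.
    move=> s a s0 Aa; apply: leq => t c t0 Ac.
    have [d Ad E] := convex_set_scaled_sum cA Aa Ac s0 t0.
    have := qle (x + y) (s + t) d (addr_ge0 s0 t0) Ad.
    by rewrite -E addrACA; have := pD (x + s *: a) (y + t *: c); lra.
  rewrite le_eqVlt => /predU1P[<-|t0].
    rewrite scale0r mul0r; apply/le_anti; rewrite -{1}p0 qp/=.
    apply: leq => s a s0 Aa.
    by rewrite add0r pZ// -mulrBr mulr_ge0// subr_ge0 bp.
  apply/le_anti; rewrite qZ_le// andbT -ler_pdivrMl//.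
  have := qZ_le t^-1 (t *: x); rewrite invr_gt0 => /(_ t0).
  by rewrite scalerA mulVf ?scale1r// gt_eqF.
- move=> a Aa; have := qle (- a) 1 a ler01 Aa.
  by rewrite scale1r addNr p0 mul1r sub0r.
Qed.

(** For [A = [set y]] and [b = p y] the minorant satisfies
    [q (- y) <= - p y <= - q y], so it is odd at [y].  A smaller sublinear
    function remains odd at [y], because [- q' (- y) <= q' y] always holds;
    this lets the vectors of [s] be treated one after the other. *)
Lemma sublinear_odd_on (R : realType) (V : lmodType R) (s : seq V)
    (p : V -> R) :
  sublinear p -> exists q : V -> R, [/\ sublinear q, forall x, q x <= p x &
    forall y, y \in s -> q (- y) = - q y].
Proof.
elim: s p => [|y s IHs] p subp; first by exists p.
have cy : convex_set ([set y] : set (convex_lmodType V)).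
  by move=> u v l; rewrite !inE => -> ->; rewrite convmm.
have [|a ->|q [subq qp qy]] := sublinear_minorant (b := p y) subp cy.
- by exists y.
- exact: lexx.
have [q' [subq' q'q q's]] := IHs q subq.
exists q'; split => // [x|x].
  exact: le_trans (qp x).
rewrite inE => /predU1P[->|/q's//]; apply/le_anti.
have := sublinear_opp_le y subq'; have := q'q (- y); have := qy y erefl.
by have := q'q y; have := qp y; lra.
Qed.

(** Once [q <= p] is odd at the vectors [e i] of a basis, [w] is the linear
    function that agrees with [q] there.  Subadditivity gives [q <= w]
    everywhere, and at [- x] this inequality reads [w x <= - q (- x) <= q x]. *)
Lemma hahn_banach_finite_dim (R : realType) (n : nat) (V : lmodType R)
    (p : V -> R) :
  Vector.axiom n V -> sublinear p ->
  exists w : {linear V -> R^o}, forall x, w x <= p x.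
Proof.
move=> [f f_lin [g fK gK]] subp.
pose e i := g (delta_mx 0 i).
have [q [[qD qZ] qp qe]] := sublinear_odd_on [seq e i | i : 'I_n] subp.
pose h x : R^o := \sum_i f x 0 i * q (e i).
have h_lin : linear h.
  move=> a x y; rewrite /h scaler_sumr -big_split; apply: eq_bigr => i _.
  by rewrite f_lin !mxE mulrDl -mulrA.
pose w : {linear V -> R^o} :=
  HB.pack h (GRing.isLinear.Build R V R^o _ h h_lin).
have qeZ i t : q (t *: e i) = t * q (e i).
  have [t0|/ltW t0] := leP 0 t; first exact: qZ.
  rewrite -[LHS]/(q _) -(opprK t) scaleNr -scalerN qZ ?oppr_ge0// qe.
    by ring.
  by apply: map_f; rewrite mem_enum.
have eE x : x = \sum_i f x 0 i *: e i.
  pose fl : {linear V -> 'rV[R]_n} :=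
    HB.pack f (GRing.isLinear.Build R V 'rV[R]_n _ f f_lin).
  apply: (can_inj fK); rewrite -[f]/(fl : _ -> _) linear_sum.
  rewrite {1}[fl x]row_sum_delta; apply: eq_bigr => i _.
  by rewrite linearZ /= /e gK.
have qw x : q x <= w x.
  rewrite {1}(eE x) /w /= /h.
  elim/big_ind2: _ => [|x1 t1 x2 t2 h1 h2|i _]; last by rewrite qeZ.
    by rewrite -(scale0r (0 : V)) qZ// mul0r.
  by apply: le_trans (qD _ _) _; exact: lerD.
exists w => x; apply: le_trans (qp x).
apply: le_trans (sublinear_opp_le x (conj qD qZ)).
by rewrite lerNr -linearN.
Qed.

(** A linear [w] below a minorant [q] with [q (- a) <= - b] satisfies
    [b <= - w (- a) = w a]. *)
Lemma mazur_orlicz (R : realType) (n : nat) (V : lmodType R) (p : V -> R)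
    (A : set V) (b : R) :
  Vector.axiom n V -> sublinear p -> convex_set (A : set (convex_lmodType V)) ->
  A !=set0 -> (forall a, A a -> b <= p a) ->
  exists2 w : {linear V -> R^o}, (forall x, w x <= p x) &
    forall a, A a -> b <= w a.
Proof.
move=> dimV subp cA A0 bp.
have [q [subq qp qA]] := sublinear_minorant subp cA A0 bp.
have [w wq] := hahn_banach_finite_dim dimV subq.
exists w => [x|a Aa]; first exact: le_trans (qp x).
by have := le_trans (wq (- a)) (qA a Aa); rewrite linearN lerN2.
Qed.

(** * Supporting functionals of norm one *)

Lemma dual_sphere_le (R : realType) (E : normedModType R)
    (w : {linear E -> R^o}) x : dual_sphere w -> w x <= `|x|.
Proof.
move=> [_ w1]; have [->|x0] := eqVneq x 0; first by rewrite linear0 normr0.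
have nx : 0 < `|x| by rewrite normr_gt0.
have : (`|w (`|x|^-1 *: x)|%:E <= dual_norm w)%E.
  apply: ereal_sup_ubound; exists (`|x|^-1 *: x) => //=.
  by rewrite normrZ ger0_norm ?invr_ge0// mulVf// gt_eqF.
rewrite w1 lee_fin linearZ /= normrM ger0_norm ?invr_ge0// mulrC.
by rewrite ler_pdivrMr// mul1r; apply: le_trans; exact: ler_norm.
Qed.

(** This is [mazur_orlicz] for the norm, the convex set of the [x - a] and the
    bound [`|x - a0|].  That the distance from [x] to [A] is attained at [a0]
    makes the norm of [w] equal to 1 without rescaling: [w <= `|.|] bounds
    it above, and [w (x - a0) >= `|x - a0|] bounds it below. *)
Lemma support_functional (R : realType) (n : nat) (E : normedModType R)
    (A : set E) (x a0 : E) :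
  Vector.axiom n E -> convex_set (A : set (convex_lmodType E)) ->
  A a0 -> x != a0 -> (forall a, A a -> `|x - a0| <= `|x - a|) ->
  exists2 w : {linear E -> R^o}, dual_sphere w &
    forall a, A a -> `|x - a0| <= w (x - a).
Proof.
move=> dimE cA Aa0 xa0 mina0.
have nx : 0 < `|x - a0| by rewrite normr_gt0 subr_eq0.
have cB : convex_set ((fun a => x - a) @` A : set (convex_lmodType E)).
  move=> _ _ l /set_mem[a Aa <-] /set_mem[c Ac <-]; apply/mem_set.
  exists (conv l (a : convex_lmodType E) c); last first.
    rewrite -[LHS]/(x - (l%:num *: a + (1 - l%:num) *: c)).
    rewrite -[RHS]/(l%:num *: (x - a) + (1 - l%:num) *: (x - c)).
    exact: subr_convex_comb.
  by have := cA a c l; rewrite !inE; exact.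
have [||w wn wA] := mazur_orlicz (b := `|x - a0|) dimE (sublinear_norm E) cB.
- by exists (x - a0), a0.
- by move=> _ [a Aa <-]; exact: mina0.
have wabs z : `|w z| <= `|z|.
  by rewrite ler_norml lerNl -linearN wn andbT -normrN wn.
exists w; last by move=> a Aa; apply: wA; exists a.
split.
- move=> z; apply/cvgrPdist_lt => e e0; near=> y; rewrite -linearB.
  by apply: le_lt_trans (wabs _) _; near: y; exact: cvgr_dist_lt.
apply/le_anti/andP; split.
  by apply: ge_ereal_sup => _ [z /= z1 <-]; rewrite lee_fin (le_trans (wabs z)).
apply: le_trans (_ : (`|w (`|x - a0|^-1 *: (x - a0))|%:E <= _)%E); last first.
  apply: ereal_sup_ubound; exists (`|x - a0|^-1 *: (x - a0)) => //=.
  by rewrite normrZ ger0_norm ?invr_ge0// mulVf// gt_eqF.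
rewrite lee_fin linearZ /=; apply: le_trans (ler_norm _).
rewrite -[X in X <= _](@mulVf _ `|x - a0|) ?gt_eqF//.
by rewrite ler_wpM2l ?invr_ge0//; apply: wA; exists a0.
Unshelve. all: by end_near.
Qed.

(** * Compactness and circumradius *)

(** The parametrization [g] of [E] by coordinates is continuous, being a finite
    sum of multiples of coordinates.  On the compact unit sphere of ['rV[R]_n]
    the norm of [g v] has a minimum [m > 0], so [m * `|v| <= `|g v|] and the
    preimage of a bounded set is bounded.  Thus [C] is the continuous image of
    a closed bounded set of row vectors. *)
Lemma bounded_closed_compact_finite_dim (R : realType) (n : nat)
    (E : normedModType R) (C : set E) :
  Vector.axiom n E -> bounded_set C -> closed C -> compact C.
Proof.
move=> [f f_lin [g fK gK]] bC clC.
pose fl : {linear E -> 'rV[R]_n} :=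
  HB.pack f (GRing.isLinear.Build R E 'rV[R]_n _ f f_lin).
have g_lin : linear g by exact: (can2_linear (f := fl) fK gK).
pose gl : {linear 'rV[R]_n -> E} :=
  HB.pack g (GRing.isLinear.Build R 'rV[R]_n E _ g g_lin).
have g_cont : continuous g.
  have -> : g = (fun v => \sum_i v 0 i *: g (delta_mx 0 i)).
    apply/funext => v; rewrite {1}[v]row_sum_delta.
    rewrite -[g]/(gl : _ -> _) linear_sum; apply: eq_bigr => i _.
    by rewrite linearZ.
  apply: continuous_big => [|i _ v]; first exact: add_continuous.
  by apply: cvgZr_tmp; [exact: nbhs_filter|exact: coord_continuous].
have [m m0 gm] : exists2 m : R, 0 < m & forall v, m * `|v| <= `|g v|.
  pose S := [set v : 'rV[R]_n | `|v| = 1].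
  have kS : compact S.
    apply: bounded_closed_compact.
      by exists 1; split => // M M1 v /= ->; exact: ltW.
    apply: (@preimage_closed _ _ (fun v : 'rV[R]_n => `|v|) [set 1]).
      by move=> v _; exact: norm_continuous.
    exact: closed_eq.
  have normS v : v != 0 -> S (`|v|^-1 *: v).
    rewrite -normr_gt0 => nv.
    by rewrite /S/= normrZ ger0_norm ?invr_ge0// mulVf// gt_eqF.
  (* The sphere is empty in dimension zero; any [m] then works. *)
  have [S0|S0] := pselect (S !=set0); last first.
    exists 1 => // v; have [->|/normS Sv] := eqVneq v 0.
      by rewrite normr0 mulr0.
    by case: S0; exists (`|v|^-1 *: v).
  have [|v0 /set_mem Sv0 minv0] := compact_EVT_min (f := fun v => `|g v|) S0 kS.
    apply: continuous_subspaceT => v; apply: continuous_comp.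
      exact: g_cont.
    exact: norm_continuous.
  exists `|g v0|.
    rewrite normr_gt0; apply/eqP => gv0; move: Sv0.
    have -> : v0 = 0 by rewrite -[v0]gK gv0 -[f]/(fl : _ -> _) linear0.
    by rewrite /S/= normr0 => /eqP; rewrite eq_sym oner_eq0.
  move=> v; have [->|v_neq0] := eqVneq v 0; first by rewrite normr0 mulr0.
  have nv : 0 < `|v| by rewrite normr_gt0.
  have /mem_set/minv0 := normS v v_neq0.
  rewrite -[g]/(gl : _ -> _) linearZ normrZ ger0_norm ?invr_ge0//.
  by rewrite ler_pdivlMl// mulrC.
have -> : C = g @` (g @^-1` C).
  by apply/seteqP; split => [x Cx|_ [v Cgv <-]//]; exists (f x); rewrite /= fK.
apply: continuous_compact; first exact: continuous_subspaceT.
apply: bounded_closed_compact; last first.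
  by apply: preimage_closed => // v _; exact: g_cont.
have [M [Mreal CM]] := bC.
exists (m^-1 * (M + 1)); split; first exact: num_real.
move=> N MN v /= Cgv; apply: le_trans (ltW MN).
rewrite ler_pdivlMl//; apply: le_trans (gm v) _.
by apply: CM => //; rewrite ltrDl.
Qed.

(** With [N] points in an [r / 2]-net of [C] and [c] their average, the
    distance from [c] to [x] is at most the mean of the [N] distances from the
    net to [x]; all of these are at most [r] and one is at most [r / 2], which
    gives [d = r - r / (2 * N)]. *)
Lemma compact_circumradius_lt (R : realType) (E : normedModType R) (r : R)
    (C : set E) :
  0 < r -> compact C -> C !=set0 ->
  (forall x y, C x -> C y -> `|x - y| <= r) ->
  exists c, exists2 d, d < r & forall x, C x -> `|c - x| <= d.
Proof.
move=> r0 kC [z Cz] rC.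
have : cover_compact C by rewrite -compact_cover.
move=> /(_ E C (fun y => ball y (r / 2))) [||F FC Fcov].
- by move=> y _; exact: ball_open.
- by move=> x Cx; exists x => //; apply: ballxx; rewrite divr_gt0.
pose s : seq E := finmap.enum_fset F.
have sC y : y \in s -> C y by move=> /FC/set_mem.
have snear x : C x -> exists2 y, y \in s & `|y - x| < r / 2.
  by move=> /Fcov[y /= ys]; rewrite -ball_normE; exists y.
pose N : R := (size s)%:R.
have N0 : 0 < N.
  by have [y ys _] := snear z Cz; rewrite ltr0n lt0n size_eq0;
    apply: contraTneq ys => ->.
exists (N^-1 *: \sum_(y <- s) y); exists (r - N^-1 * (r / 2)).
  by rewrite ltrBlDr ltrDl mulr_gt0 ?invr_gt0// divr_gt0.
move=> x Cx; have [y0 y0s y0x] := snear x Cx.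
have -> : N^-1 *: (\sum_(y <- s) y) - x = N^-1 *: \sum_(y <- s) (y - x).
  rewrite big_split/= scalerDr; congr (_ + _).
  rewrite sumrN big_const_seq count_predT iter_addr_0 -scaler_nat.
  by rewrite scalerN scalerA mulVf ?gt_eqF// scale1r.
have nsum : `|\sum_(y <- s) (y - x)| <= \sum_(y <- s) `|y - x|.
  exact: ler_norm_sum.
(* All terms are nonnegative and the one at [y0] is at least [r / 2]. *)
have gap : r / 2 <= \sum_(y <- s) (r - `|y - x|).
  rewrite (big_rem y0)//=; apply: le_trans (_ : r - `|y0 - x| <= _).
    by lra.
  rewrite lerDl big_seq; apply: sumr_ge0 => y /mem_rem ys.
  by rewrite subr_ge0 rC//; exact: sC.
rewrite normrZ (ger0_norm (ltW _)) ?invr_gt0//.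
rewrite ler_pdivrMl// mulrBr mulVKf ?gt_eqF//.
apply: le_trans nsum _; move: gap; rewrite big_split/= sumrN.
rewrite big_const_seq count_predT iter_addr_0 -mulr_natl -/N; lra.
Qed.

(** * Maximal sets of bounded diameter *)

Lemma r_boundedP (R : realType) (E : normedModType R) (r : R) (C : set E) :
  r_bounded r C <-> forall x y, C x -> C y -> `|x - y| <= r.
Proof.
split=> [rC x y Cx Cy|rC].
  rewrite -lee_fin; apply: le_trans rC; apply: ereal_sup_ubound.
  by exists (x, y).
by apply: ge_ereal_sup => _ [[x y] [/= Cx Cy] <-]; rewrite lee_fin rC.
Qed.

(** Maximality is applied to [C `|` [set y]], which is [r]-bounded when [y] is
    within [r] of all points of [C]. *)
Lemma r_maximal_balls (R : realType) (E : normedModType R) (r : R) (C : set E) :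
  0 <= r -> r_maximal r C -> C = [set y | forall x, C x -> `|x - y| <= r].
Proof.
move=> r0 [/r_boundedP rC maxC]; apply/seteqP; split=> [y Cy x Cx|y Cy].
  exact: rC.
have <- : C `|` [set y] = C; last by right.
apply: maxC; last by move=> x; left.
apply/r_boundedP => u v [Cu|->] [Cv|->].
- exact: rC.
- exact: Cy.
- by rewrite distrC; exact: Cy.
- by rewrite subrr normr0.
Qed.

Lemma r_maximal_convex (R : realType) (E : normedModType R) (r : R)
    (C : set E) :
  0 <= r -> r_maximal r C -> convex_set (C : set (convex_lmodType E)).
Proof.
move=> r0 /(r_maximal_balls r0) ->.
move=> a b l /set_mem Ca /set_mem Cb; apply/mem_set => x Cx.
rewrite -[X in x - X]/(l%:num *: a + (1 - l%:num) *: b).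
rewrite subr_convex_comb.
have l0 : 0 <= l%:num by [].
have l1 : 0 <= 1 - l%:num by rewrite subr_ge0.
apply: le_trans (ler_normD _ _) _; rewrite !normrZ !ger0_norm//.
have := ler_wpM2l l0 (Ca x Cx); have := ler_wpM2l l1 (Cb x Cx); lra.
Qed.

(** The intersection of balls is over an empty family if [C] is empty, and is
    then the whole space. *)
Lemma r_maximal_nonempty (R : realType) (E : normedModType R) (r : R)
    (C : set E) :
  0 <= r -> r_maximal r C -> C !=set0.
Proof.
move=> r0 Cmax; apply/set0P/eqP => C0.
by have : C 0; [rewrite (r_maximal_balls r0 Cmax) => x; rewrite C0|rewrite C0].
Qed.

Lemma r_maximal_compact (R : realType) (n : nat) (E : normedModType R) (r : R)
    (C : set E) :
  Vector.axiom n E -> 0 <= r -> r_maximal r C -> compact C.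
Proof.
move=> dimE r0 Cmax; apply: (bounded_closed_compact_finite_dim dimE).
  have [z Cz] := r_maximal_nonempty r0 Cmax.
  exists (`|z| + r); split=> [|M rM y Cy]; first exact: num_real.
  have /r_boundedP/(_ _ _ Cz Cy) zy := Cmax.1.
  apply: le_trans (ltW rM); rewrite -[y](subKr z).
  by apply: le_trans (ler_normB _ _) _; rewrite lerD2l.
rewrite (r_maximal_balls r0 Cmax).
have -> : [set y | forall x, C x -> `|x - y| <= r] =
    \bigcap_(x in C) ((fun y => `|x - y|) @^-1` [set t | t <= r]) by [].
apply: closed_bigI => x _; apply: preimage_closed; last exact: closed_le.
by move=> y _; apply: cvg_norm; apply: cvgB; [exact: cvg_cst|exact: cvg_id].
Qed.

(** If [C] lies within [d < r] of [c], every point within [r - d] of [c] is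
    within [r] of all points of [C]. *)
Lemma r_maximal_interior (R : realType) (n : nat) (E : normedModType R) (r : R)
    (C : set E) :
  Vector.axiom n E -> 0 < r -> r_maximal r C -> interior C !=set0.
Proof.
move=> dimE r0 Cmax; have r0' := ltW r0.
have /r_boundedP rC := Cmax.1.
have [c [d dr cd]] := compact_circumradius_lt r0
  (r_maximal_compact dimE r0' Cmax) (r_maximal_nonempty r0' Cmax) rC.
exists c; apply/nbhs_ballP; exists (r - d); first by rewrite /= subr_gt0.
move=> y; rewrite -ball_normE /= => cy.
rewrite (r_maximal_balls r0' Cmax) => x Cx /=.
rewrite -(subrKA c); apply: le_trans (ler_normD _ _) _.
by rewrite distrC; have := cd x Cx; lra.
Qed.

(** * Sets of constant diameter *)

(** A point [y] outside [C] is separated from [C] by a functional of norm 1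
    with gap [`|y - c0|]; adding this gap to two points of [C] whose values
    differ by almost [r] exceeds [r]. *)
Lemma constant_diameter_maximal (R : realType) (n : nat) (E : normedModType R)
    (r : R) (C : set E) :
  Vector.axiom n E -> (0 < n)%N -> 0 < r -> compact C ->
  convex_set (C : set (convex_lmodType E)) ->
  constant_diameter r C -> r_maximal r C.
Proof.
move=> dimE n_gt0 r_gt0 kC cC dC.
have norming (u : E) : u != 0 ->
    exists2 w : {linear E -> R^o}, dual_sphere w & `|u| <= w u.
  move=> u0; have c0 : convex_set ([set 0] : set (convex_lmodType E)).
    by move=> x y l; rewrite !inE => -> ->; rewrite convmm.
  have [|w sw wu] := support_functional dimE c0 (erefl _) u0.
    by move=> a ->.
  by exists w => //; have := wu 0 erefl; rewrite subr0.
(* The supremum defining the diameter of the empty set is [-oo], so one unit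
   functional is enough to exclude it; this is where [0 < n] matters. *)
have C0 : C !=set0.
  have [f f_lin [g fK gK]] := dimE.
  pose fl : {linear E -> 'rV[R]_n} :=
    HB.pack f (GRing.isLinear.Build R E 'rV[R]_n _ f f_lin).
  have g0 : g (const_mx 1) != 0.
    apply/eqP => /(congr1 f); rewrite gK -[f]/(fl : _ -> _) linear0.
    move=> /rowP/(_ (Ordinal n_gt0)); rewrite !mxE => /eqP.
    by rewrite oner_eq0.
  have [w sw _] := norming _ g0; apply/set0P/eqP => C0.
  by have := dC w sw; rewrite /omega_diam C0 set0X image_set0 ereal_sup0.
split.
  apply/r_boundedP => x y Cx Cy.
  have [->|xy] := eqVneq x y; first by rewrite subrr normr0 ltW.
  have xy0 : x - y != 0 by rewrite subr_eq0.
  have [w sw wxy] := norming _ xy0.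
  rewrite -lee_fin -(dC w sw) (@le_trans _ _ (w (x - y))%:E) ?lee_fin//.
  by apply: ereal_sup_ubound; exists (x, y).
move=> D /r_boundedP rD CD; apply/seteqP; split => // y Dy.
apply: contrapT => nCy.
have [|c0 /set_mem Cc0 minc0] := compact_EVT_min (f := fun c => `|y - c|) C0 kC.
  apply: continuous_subspaceT => c; apply: cvg_norm.
  by apply: cvgB; [exact: cvg_cst|exact: cvg_id].
have yc0 : y != c0 by apply: contra_notN nCy => /eqP->.
have [|w sw wC] := support_functional dimE cC Cc0 yc0.
  by move=> a Ca; apply: minc0; exact: mem_set.
have nb : 0 < `|y - c0| by rewrite normr_gt0 subr_eq0.
have : ((r - `|y - c0|)%:E < omega_diam w C)%E.
  by rewrite dC// lte_fin ltrBlDr ltrDl.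
move=> /ereal_sup_gt[_ [[c1 c2] [/= Cc1 Cc2] <-]]; rewrite lte_fin.
have := rD y c2 Dy (CD _ Cc2).
have := dual_sphere_le (y - c2) sw.
have := wC c1 Cc1.
by rewrite !linearB /=; lra.
Qed.

Theorem theorem0p2 (R : realType) (n : nat) (E : normedModType R) (r : R)
    (n_ge1 : (1 <= n)%N) (dimE : Vector.axiom n E) (r_gt0 : 0 < r) :
  (forall C : set E, r_maximal r C ->
     [/\ compact C, convex_set (C : set (convex_lmodType E)) &
         interior C !=set0]) /\
  (forall C : set E, compact C -> convex_set (C : set (convex_lmodType E)) ->
     constant_diameter r C -> r_maximal r C).
Proof.
split=> [C Cmax|C kC cC dC].
  split; first exact: (r_maximal_compact dimE (ltW r_gt0)).
    exact: (r_maximal_convex (ltW r_gt0)).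
  exact: (r_maximal_interior dimE r_gt0).
exact: (constant_diameter_maximal dimE).
Qed.
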